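(* Let $G$ be a locally compact second-countable Hausdorff topological group and $X$ a second-countable metric space. If $S\subset C_s(G,X)$ satisfies the compactness axiom and $X$ is locally compact, then $S^*W$ is metrizable for each subset $W\subset G\times X$.
   Context: A partial map from $G$ to $X$ is a continuous map $\phi:D\to X$ with $D\subset G$ nonempty and open; $\mathrm{dom}\,\phi:=D$. The set $C_p(G,X)$ of partial maps has the topology with subbasis the sets $W(K,U)=\{\phi\mid K\subset\mathrm{dom}\,\phi,\ \phi(K)\subset U\}$, $K\subset G$ compact, $U\subset X$ open. A partial map $\phi$ with nonempty connected domain is maximally defined if, for every partial map $\psi$ with nonempty connected domain, $\mathrm{dom}\,\phi\subset\mathrm{dom}\,\psi$ and $\phi=\psi$ on $\mathrm{dom}\,\phi$ imply $\phi=\psi$. $C_s(G,X)\subset C_p(G,X)$ is the subspace of maximally defined partial maps. For $S\subset C_s(G,X)$ and $W\subset G\times X$, $S^*W:=\{(g,\phi)\mid\phi\in S,\ g\in\mathrm{dom}\,\phi,\ (g,\phi(g))\in W\}$, with the subspace topology from $G\times C_s(G,X)$. $S$ satisfies the compactness axiom if $S^*W$ is compact for all compact $W\subset G\times X$. *)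

(* Defs.v *)
From HB Require Import structures.
From mathcomp Require Import all_boot all_order all_algebra.
From mathcomp Require Import all_classical all_reals.
From mathcomp Require Import topology.

Set Implicit Arguments.
Unset Strict Implicit.
Unset Printing Implicit Defensive.

Import Order.TTheory GRing.Theory Num.Theory.

Local Open Scope classical_set_scope.
Local Open Scope ring_scope.

HB.mixin Record isTopologicalGroup G of Topological G & Group G := {
  mulg_continuous : continuous (fun gh : G * G => (gh.1 * gh.2)%g) ;
  invg_continuous : continuous (fun g : G => g^-1%g) }.

#[short(type="topologicalGroupType")]
HB.structure Definition TopologicalGroup :=
  {G of Topological G & Group G & isTopologicalGroup G}.

(* A set coerces to the type [set_type] of its elements, which carries the
   subspace topology; [set_val] is the inclusion. *)

Record partial_map (G X : topologicalType) := PartialMap {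
  dom : set G ;
  pmap_fun :> dom -> X ;
  dom_open : open dom ;
  dom_neq0 : dom !=set0 ;
  pmap_continuous : continuous pmap_fun }.

Section PartialMaps.
Context {G X : topologicalType}.
Implicit Types phi psi : partial_map G X.

(* [W(K, U)] *)
Definition pmap_subbasic (KU : set G * set X) : set (partial_map G X) :=
  [set phi | KU.1 `<=` dom phi /\ phi @` (set_val @^-1` KU.1) `<=` KU.2].

HB.instance Definition _ := gen_eqMixin (partial_map G X).
HB.instance Definition _ := gen_choiceMixin (partial_map G X).
HB.instance Definition _ := isSubBaseTopological.Build (partial_map G X)
  [set KU : set G * set X | compact KU.1 /\ open KU.2] pmap_subbasic.

Definition connected_dom phi := connected (dom phi).

Definition pmap_extends phi psi :=
  dom phi `<=` dom psi /\
  forall (g : dom phi) (h : dom psi), set_val g = set_val h -> phi g = psi h.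

Definition maximally_defined phi :=
  connected_dom phi /\
  forall psi, connected_dom psi -> pmap_extends phi psi -> phi = psi.

End PartialMaps.

Definition C_s (G X : topologicalType) : set (partial_map G X) :=
  [set phi | maximally_defined phi].
Arguments C_s : clear implicits.

Section CompactnessAxiom.
Context {G X : topologicalType}.
Implicit Types (S : set (C_s G X)) (W : set (G * X)).

Definition star S W : set (G * C_s G X) :=
  [set p | S p.2 /\ exists g : dom (set_val p.2),
             set_val g = p.1 /\ W (p.1, set_val p.2 g)].

Definition compactness_axiom S := forall W, compact W -> compact (star S W).

End CompactnessAxiom.

Definition metrizable (R : realType) (T : topologicalType) :=
  exists d : T -> T -> R,
    [/\ forall x y, d x y = 0 <-> x = y,
        forall x y, d x y = d y x,
        forall x y z, d x z <= d x y + d y z &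
        forall x : T, nbhs x = nbhs_ball_ (fun y e => [set z | d y z < e]) x].

(* Main.v *)
Require Import Defs.
From mathcomp Require Import all_boot all_order all_algebra.
From mathcomp Require Import all_classical all_reals.
From mathcomp Require Import topology.
From mathcomp Require Import interval_inference normedtype lra.

(** Since [G] is locally compact and both [G] and [X] are second countable, the
sets [W(closure A, V)], for [A] with compact closure and [V] running over
countable bases, form a subbasis of [C_p(G, X)]; so [C_p(G, X)], and hence
[S^*W], is second countable. Two maximally defined maps whose domains meet and
that agree where both are defined extend to the union of their domains, hence
are equal: this makes [S^*W] Hausdorff, although [C_s(G, X)] need not be. For
compact neighborhoods [K] of [g] and [L] of [phi(g)], the compactness axiom
makes [S^*(K x L)] a compact neighborhood of [(g, phi)] in [S^*(G x X)]. Thus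
[S^*(G x X)] is locally compact Hausdorff, so completely regular, and Urysohn's
metrization theorem applies to it and to its subspaces [S^*W]. *)

Import Order.TTheory GRing.Theory Num.Theory.
Import numFieldNormedType.Exports.

Local Open Scope classical_set_scope.

(** * Subspaces, cluster points and second countability *)

Lemma nbhs_initialP (S : choiceType) (T : topologicalType) (f : S -> T)
    (x : initial_topology f) (A : set S) :
  nbhs x A <-> exists2 B, nbhs (f x) B & f @^-1` B `<=` A.
Proof.
split=> [[_ [[B oB <-] Bx BA]]|[B Bx BA]].
  by exists B => //; exact: open_nbhs_nbhs.
apply: (@filterS _ (nbhs x) _ _ _ BA); exact: initial_continuous Bx.
Qed.

Lemma nbhs_set_typeP (T : topologicalType) (A : set T) (x : A) (B : set A) :
  nbhs x B <-> exists2 C, nbhs (set_val x) C & set_val @^-1` C `<=` B.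
Proof. exact: nbhs_initialP. Qed.

Lemma set_val_continuous (T : topologicalType) (A : set T) :
  continuous (@set_val T A).
Proof. exact: initial_continuous. Qed.

(** Hausdorffness says that two points whose neighborhoods always meet are equal; this carries such
    pairs along continuous maps. *)
Lemma cluster_continuous {S T : topologicalType} (f : S -> T) {x y : S} :
  continuous f -> cluster (nbhs x) y -> cluster (nbhs (f x)) (f y).
Proof.
move=> cf xy A B /cf fA /cf fB; have [z [? ?]] := xy _ _ fA fB.
by exists (f z).
Qed.

(** The last hypothesis, convergence tested on [C], says that [C] is a subbasis. Applied to the
    filter generated by the finite intersections around [x], it makes these a basis at [x]. *)
Lemma countable_subbase (T : topologicalType) (C : set (set T)) :
  countable C -> C `<=` open ->
  (forall (x : T) (F : set_system T), Filter F ->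
    (forall A, C A -> A x -> F A) -> F --> x) ->
  @second_countable T.
Proof.
move=> cC oC hC; exists (finI_from C id); first exact: finI_from_countable.
split=> [_ [D DC <-]|x].
  rewrite openE => x Dx; apply: filter_bigI => A DA.
  by apply: open_nbhs_nbhs; split; [exact/oC/set_mem/DC | exact: Dx].
apply: hC.
  apply: filter_from_filter.
    have : (\bigcup_(A in finI_from C id) A) x by rewrite finI_from_cover.
    by move=> [A CA Ax]; exists A.
  move=> A B [CA Ax] [CB Bx]; exists (A `&` B) => //; split=> //.
  exact: finI_fromI.
by move=> A CA Ax; exists A => //; split => //; exact: (@finI_from1 _ _ C id).
Qed.

Lemma second_countable_set_type (T : topologicalType) (A : set T) :
  @second_countable T -> @second_countable A.
Proof.
move=> [B cB [oB hB]]; exists [set set_val @^-1` U | U in B].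
  exact: (card_le_trans (card_image_le _ _)).
split=> [_ [U BU <-]|x P /nbhs_set_typeP[Q /hB[U /= [BU Ux] UQ] QP]].
  by exists U => //; exact: oB.
exists (set_val @^-1` U); first by split => //; exists U.
by move=> y /= /UQ /QP.
Qed.

Lemma second_countable_prod (T U : topologicalType) :
  @second_countable T -> @second_countable U -> @second_countable (T * U)%type.
Proof.
move=> [B cB [oB hB]] [C cC [oC hC]].
exists [set P.1 `*` P.2 | P in B `*` C].
  by apply: (card_le_trans (card_image_le _ _)); exact: countableX.
split=> [_ [[V W]] /= [BV CW] <-|[x y] P [[V W]] /=].
  rewrite openE => -[x y] [Vx Wy]; exists (V, W) => //; split=> /=.
    by apply: open_nbhs_nbhs; split => //; exact: oB.
  by apply: open_nbhs_nbhs; split => //; exact: oC.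
move=> [/hB[V' [BV' V'x] V'V] /hC[W' [CW' W'y] W'W]] VWP.
exists (V' `*` W'); first by split => //; exists (V', W').
by move=> [a b] [/V'V ? /W'W ?]; exact: VWP.
Qed.

(** * The compact-open topology on partial maps *)

Section PartialMaps.
Context {G X : topologicalType}.
Implicit Types phi psi : partial_map G X.

(** As an inclusion of [K] in one set, membership can be checked point by point, the form that
    near-covering compactness needs. *)
Lemma pmap_subbasicP phi (K : set G) (U : set X) :
  pmap_subbasic (K, U) phi <->
  K `<=` [set x | exists2 h : dom phi, set_val h = x & U (phi h)].
Proof.
split=> [[/= Kd KU] x Kx|KU].
  have hx : x \in dom phi by apply/mem_set/Kd.
  exists (exist _ x hx) => //; apply: KU.
  by exists (exist _ x hx).
split=> [x /KU [h <- _]|_ [h /= Kh <-]]; first exact: set_valP.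
have [h' hh' Uh'] := KU _ Kh.
by rewrite (_ : h = h') //; apply: val_inj.
Qed.

Lemma nbhs_pmap_subbasic phi (K : set G) (U : set X) :
  compact K -> open U -> pmap_subbasic (K, U) phi ->
  nbhs phi (pmap_subbasic (K, U)).
Proof.
move=> cK oU hphi; apply: open_nbhs_nbhs; split => //.
exists [set pmap_subbasic (K, U)]; last by rewrite bigcup_set1.
move=> _ ->.
pose D := [set KU : set G * set X | compact KU.1 /\ open KU.2].
exact: (@finI_from1 _ _ D pmap_subbasic (K, U)).
Qed.

Lemma filter_cvg_pmap phi (F : set_system (partial_map G X)) :
  Filter F ->
  (forall K U, compact K -> open U -> pmap_subbasic (K, U) phi ->
    F (pmap_subbasic (K, U))) ->
  F --> phi.
Proof.
move=> FF hF A [_ [[D' D'D <-] [B D'B Bphi] DA]].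
have [E ED EB] := D'D _ D'B.
apply: (@filterS _ _ _ B); first by move=> psi Bpsi; apply: DA; exists B.
rewrite -EB; apply: filter_bigI => -[K U] DKU.
have [/= cK oU] := set_mem (ED _ DKU).
by apply: hF => //; move: Bphi; rewrite -EB; exact.
Qed.

Lemma nbhs_pmap_val phi (g : dom phi) (N : set X) : nbhs (phi g) N ->
  exists2 O, nbhs (set_val g) O &
    O `<=` [set x | exists2 h : dom phi, set_val h = x & N (phi h)].
Proof.
move=> /(@pmap_continuous _ _ phi)/nbhs_set_typeP[O Og ON].
exists (O `&` dom phi).
  apply: filterI => //; apply: open_nbhs_nbhs; split; first exact: dom_open.
  exact: set_valP.
move=> x [Ox /mem_set dx]; exists (exist _ x dx) => //.
exact: (ON (exist _ x dx)).
Qed.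

(** Locally compact Hausdorff spaces are regular, so a closed neighborhood of the point fits inside
    a compact set, [N] and the preimage of [U] at once. *)
Lemma compact_nbhs_pmap_subbasic [phi] [g : dom phi] [N : set G] [U : set X] :
  hausdorff_space G -> locally_compact [set: G] ->
  nbhs (set_val g) N -> nbhs (phi g) U ->
  exists K, [/\ nbhs (set_val g) K, compact K, K `<=` N &
    pmap_subbasic (K, U) phi].
Proof.
move=> hG lG Ng /nbhs_pmap_val[O Og OU].
have [V] := lG (set_val g) I; rewrite withinET => Vg [cV _].
have : nbhs (set_val g) (V `&` (O `&` N)) by do 2 apply: filterI => //.
move=> /(compact_regular hG cV Vg)[P Pg PVON].
exists (closure P); split.
- exact: filterS (@subset_closure _ P) Pg.
- apply: (subclosed_compact _ cV); first exact: closed_closure.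
  by move=> x /PVON[].
- by move=> x /PVON[_ []].
- by apply/pmap_subbasicP => x /PVON[_ [/OU]].
Qed.

Lemma second_countable_pmap :
  hausdorff_space G -> locally_compact [set: G] -> @second_countable G ->
  @second_countable X -> @second_countable (partial_map G X).
Proof.
move=> hG lG [B cB [oB hB]] [C cC [oC hC]].
pose D := [set AV : set G * set X | compact (closure AV.1)] `&` B `*` C.
pose W := [set pmap_subbasic (closure AV.1, AV.2) | AV in D].
apply: (@countable_subbase _ W).
- apply: (card_le_trans (card_image_le _ _)).
  apply: (@sub_countable _ _ _ (B `*` C)); last exact: countableX.
  by apply: subset_card_le => ? [].
- move=> _ [[A V] [/= cA [/= BA CV]] <-].
  rewrite openE => phi hphi; apply: nbhs_pmap_subbasic => //; exact: oC.
move=> phi F FF hF; apply: filter_cvg_pmap => K U cK oU /pmap_subbasicP KU.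
suff : \forall psi \near F,
    K `<=` [set x | exists2 h : dom psi, set_val h = x & U (psi h)].
  by apply: filterS => psi; move/pmap_subbasicP.
(* Near-covering compactness, with parameter filter [F], leaves a local task: around each point of
   [K], one basic [A] and one set of the countable subbasis. *)
move/compact_near_coveringP : cK; apply => x /KU[g <- Ug].
have /hC[V /= [CV Vg] VU] : nbhs (phi g) U by apply: open_nbhs_nbhs.
have Vg' : nbhs (phi g) V by apply: open_nbhs_nbhs; split => //; exact: oC.
have [L [Lg cL _ LV]] :=
  compact_nbhs_pmap_subbasic hG lG filterT Vg'.
have [A /= [BA Ag] AL] := hB _ _ Lg.
have cAL : closure A `<=` L.
  by rewrite ((closure_id L).1 (compact_closed hG cL)); exact: closureS.
exists (A, pmap_subbasic (closure A, V)).
  split => /=; first by apply: open_nbhs_nbhs; split => //; exact: oB.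
  apply: hF.
    exists (A, V) => //; split => //=.
    by apply: (subclosed_compact _ cL cAL); exact: closed_closure.
  by apply/pmap_subbasicP => y /cAL; move/pmap_subbasicP : LV; exact.
move=> [y psi] /= [Ay /pmap_subbasicP hpsi].
have [h hy Vh] := hpsi _ (subset_closure Ay).
by exists h => //; exact: VU.
Qed.

(** The union of the domains is connected because they meet, so the glued map is admissible in the
    maximality of both maps. *)
Lemma maximally_defined_eq phi psi : maximally_defined phi ->
  maximally_defined psi -> dom phi `&` dom psi !=set0 ->
  (forall (g : dom phi) (h : dom psi), set_val g = set_val h ->
    phi g = psi h) ->
  phi = psi.
Proof.
move=> [cphi mphi] [cpsi mpsi] meet agree.
pose D := dom phi `|` dom psi.
(* The value must match each map that is defined at [x]; [agree] makes this consistent on the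
   overlap. *)
have /choice[f fP] (x : D) : exists y,
    (forall g : dom phi, set_val g = set_val x -> phi g = y) /\
    (forall h : dom psi, set_val h = set_val x -> psi h = y).
  have [/mem_set dx|/mem_set dx] := set_valP x.
    pose g : dom phi := SigSub dx.
    exists (phi g); split=> [g' g'x|h hx].
      by congr (phi _); exact: val_inj.
    by apply/esym/agree.
  pose g : dom psi := SigSub dx.
  exists (psi g); split=> [h hx|g' g'x]; first exact: agree.
  by congr (psi _); exact: val_inj.
have oD : open D by apply: openU; exact: dom_open.
have D0 : D !=set0 by case: meet => x [? _]; exists x; left.
have cf : continuous f.
  move=> x N Nx; apply/nbhs_set_typeP.
  have [/mem_set dx|/mem_set dx] := set_valP x.
    pose g : dom phi := SigSub dx.
    have /nbhs_pmap_val[O Og ON] : nbhs (phi g) N by rewrite ((fP x).1 g).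
    by exists O => // y /ON[h hy] /=; rewrite ((fP y).1 h).
  pose g : dom psi := SigSub dx.
  have /nbhs_pmap_val[O Og ON] : nbhs (psi g) N by rewrite ((fP x).2 g).
  by exists O => // y /ON[h hy] /=; rewrite ((fP y).2 h).
pose chi := PartialMap oD D0 cf.
have cchi : connected_dom chi by exact: connectedU.
have phichi : pmap_extends phi chi.
  by split=> [x|g x gx]; [left | exact: (fP x).1].
have psichi : pmap_extends psi chi.
  by split=> [x|h x hx]; [right | exact: (fP x).2].
by rewrite (mphi _ cchi phichi) -(mpsi _ cchi psichi).
Qed.

(** Singletons are compact, so inseparable maps have inseparable values at each common point. *)
Lemma cluster_pmap_eq phi psi (g : dom phi) (h : dom psi) :
  hausdorff_space X -> cluster (nbhs phi) psi -> set_val g = set_val h ->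
  phi g = psi h.
Proof.
move=> hX phipsi gh; apply: hX => U V; rewrite !nbhsE.
move=> [U' [oU' U'g] U'U] [V' [oV' V'h] V'V].
have Wphi : nbhs phi (pmap_subbasic ([set set_val g], U')).
  apply: nbhs_pmap_subbasic => //; first exact: compact_set1.
  by apply/pmap_subbasicP => _ ->; exists g.
have Wpsi : nbhs psi (pmap_subbasic ([set set_val g], V')).
  apply: nbhs_pmap_subbasic => //; first exact: compact_set1.
  by apply/pmap_subbasicP => _ ->; exists h.
have [chi [/pmap_subbasicP chiU /pmap_subbasicP chiV]] := phipsi _ _ Wphi Wpsi.
have [a ag U'a] := chiU _ erefl; have [b bg V'b] := chiV _ erefl.
exists (chi a); split; first exact: U'U.
by rewrite (_ : a = b); [exact: V'V | apply: val_inj; rewrite -!set_valE ag].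
Qed.

End PartialMaps.

(** * Urysohn's metrization theorem *)

Section Metrization.
Local Open Scope ring_scope.
Context {R : realType} {T : topologicalType}.

(** The distance is the supremum over [n] of [|f n x - f n y| / (n+1)]. After weighting, the fixed
    gap [2^-1] becomes a positive radius, so each neighborhood contains a ball. *)
Lemma metrizable_of_functions (f : nat -> T -> R) :
  (forall n, continuous (f n)) -> (forall n x, 0 <= f n x <= 1) ->
  hausdorff_space T ->
  (forall x U, nbhs x U ->
    exists n, forall y, `|f n x - f n y| < 2^-1 -> U y) ->
  metrizable R T.
Proof.
move=> cf f01 hT sepf.
(* The weights 1/(n+1) tend to 0, so only finitely many of the [f n] matter for
   the continuity of the resulting distance. *)
pose D x y : set R := range (fun n => `|f n x - f n y| / n.+1%:R).
have dist_le1 n x y : `|f n x - f n y| <= 1.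
  by move: (f01 n x) (f01 n y); rewrite ler_norml; lra.
have ubD x y : ubound (D x y) 1.
  move=> _ [n _ <-]; rewrite ler_pdivrMr ?ltr0n// mul1r.
  by apply: le_trans (dist_le1 n x y) _; rewrite ler1n.
have D0 x y : D x y !=set0 by exists (`|f 0%N x - f 0%N y| / 1%:R), 0%N.
have D_le n x y : `|f n x - f n y| / n.+1%:R <= sup (D x y).
  by apply: ub_le_sup; [exists 1; exact: ubD | exists n].
have le_D x y c : (forall n, `|f n x - f n y| / n.+1%:R <= c) ->
    sup (D x y) <= c.
  by move=> h; apply: ge_sup => // _ [n _ <-]; exact: h.
have D_ge0 x y : 0 <= sup (D x y).
  by apply: le_trans (D_le 0%N x y); rewrite divr_ge0.
have D_small x U : nbhs x U ->
    exists2 e, 0 < e & forall y, sup (D x y) < e -> U y.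
  move=> /sepf[n hn]; exists (2^-1 / n.+1%:R).
    by rewrite divr_gt0 ?invr_gt0 ?ltr0n.
  move=> z Dz; apply: hn; have := le_lt_trans (D_le n x z) Dz.
  by rewrite ltr_pM2r ?invr_gt0 ?ltr0n.
exists (fun x y => sup (D x y)); split=> [x y|x y|x y z|x].
- split=> [Dxy|->]; last first.
    apply/eqP; rewrite eq_le D_ge0 andbT; apply: le_D => n.
    by rewrite subrr normr0 mul0r.
  apply: hT => U V xU /nbhs_singleton Vy; exists y; split => //.
  by have [e e0] := D_small x U xU; apply; rewrite Dxy.
- by congr sup; apply: eq_imagel => n _; rewrite distrC.
- apply: le_D => n; apply: le_trans (lerD (D_le n x y) (D_le n y z)).
  by rewrite -mulrDl ler_pM2r ?invr_gt0 ?ltr0n// ler_distD.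
apply/seteqP; split=> [U /D_small[e e0 eU]|U [e /= e0 eU]].
  by exists e.
(* The target is [e / 2] because a supremum of terms below a bound is only at most that bound. *)
have [N _ hN] := near_infty_natSinv_lt (PosNum (divr_gt0 e0 (ltr0n R 2))).
have : \forall y \near x, forall n, (n < N)%N -> `|f n x - f n y| < e / 2.
  elim: N {hN} => [|N IH]; first exact: nearW.
  have fN : \forall y \near x, `|f N x - f N y| < e / 2.
    by move/cvgrPdist_lt : (cf N x); apply; rewrite divr_gt0.
  move: IH fN; apply: filterS2 => y IH fN n.
  by rewrite ltnS leq_eqVlt => /predU1P[->//|]; exact: IH.
apply: filterS => y hy; apply: eU => /=.
apply: (@le_lt_trans _ _ (e / 2)); last by lra.
apply: le_D => n; have [nN|Nn] := ltnP n N.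
  apply: le_trans (ltW (hy _ nN)); rewrite ler_pdivrMr ?ltr0n//.
  by rewrite ler_peMr// ler1n.
by apply: le_trans (ltW (hN n Nn)); rewrite ler_pdivrMr ?ltr0n// mulVf.
Qed.

(** Each pair of basis sets [W], [V] gets one function below 1/4 on [W] and equal to 1 off [V], if
    there is one. Complete regularity and continuity supply such a [W] around [x] for every basic
    [V] containing [x]; the gap of more than 3/4 exceeds 1/2. *)
Lemma completely_regular_metrizable : completely_regular_space T ->
  hausdorff_space T -> @second_countable T -> metrizable R T.
Proof.
move=> crT hT [B /countable_injP[k kinj] [oB hB]].
(* [e] enumerates the basis [B], with junk value [set0]. *)
pose e n := \bigcup_(A in [set A | B A /\ k A = n]) A.
have ek A : B A -> e (k A) = A.
  move=> BA; rewrite /e (_ : [set _ | _] = [set A]) ?bigcup_set1//.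
  apply/seteqP; split=> [A' [BA' kA']|_ ->//].
  by apply: kinj => //; exact/mem_set.
pose sep (ij : nat * nat) (h : T -> R) :=
  (forall x, e ij.1 x -> h x < 4^-1) /\ (forall x, ~ e ij.2 x -> h x = 1).
pose unit_fun (h : T -> R) := continuous h /\ forall x, 0 <= h x <= 1.
(* Where no separating function exists, the constant 0 fills in. *)
have /choice[f fP] ij : exists h, unit_fun h /\
    ((exists2 h, unit_fun h & sep ij h) -> sep ij h).
  have [[h uh sh]|nh] := pselect (exists2 h, unit_fun h & sep ij h).
    by exists h.
  exists (cst 0); split => //; split=> [x|x]; first exact: cvg_cst.
  by rewrite lexx ler01.
(* Numbers that code no pair default to [(0, 0)]; every pair still has a code. *)
pose g n := f (odflt (0%N, 0%N) (unpickle n)).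
apply: (@metrizable_of_functions g) => // [n|n x|x U /hB[V /= [BV Vx] VU]].
- exact: (fP _).1.1.
- exact: (fP _).1.2.
have : uniform_separator [set x] (~` V).
  by apply: crT; [apply: open_closedC; exact: oB | exact].
move=> /(@uniform_separatorP _ R)[h [ch h01 hx hV]].
have : \forall y \near x, h y < 4^-1.
  apply: (cvgr_lt (h x)); first exact: ch.
  by rewrite (hx (h x)) ?invr_gt0 ?ltr0n//; exists x.
move=> /hB[W /= [BW Wx] Wh].
have [_] := fP (k W, k V).
have ex_sep : exists2 h, unit_fun h & sep (k W, k V) h.
  exists h; first split => // y.
    by have := h01 (h y); rewrite /= in_itv /=; apply; exists y.
  split=> y /=; rewrite ek//; first exact: Wh.
  by move=> Vy; apply: hV; exists y.
move=> /(_ ex_sep)[/= fW fV].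
exists (pickle (k W, k V)) => y; rewrite /g pickleK /= => fxy.
apply: VU; apply: contrapT => nVy; move: fxy.
have := fW x; rewrite ek// => /(_ Wx).
have -> : f (k W, k V) y = 1 by apply: fV; rewrite ek.
by rewrite ltr_norml; lra.
Qed.

End Metrization.

(** * Compactness and metrizability in subspaces *)

Lemma compact_set_type (T : topologicalType) (A C : set T) :
  compact C -> C `<=` A -> compact (set_val @^-1` C : set A).
Proof.
move=> cC CA F PF FC.
have [x [Cx clx]] := cC (set_val @ F) _ FC.
pose a : A := SigSub (mem_set (CA _ Cx)).
exists a; split => // P Q FP /nbhs_set_typeP[V Va VQ].
have [_ [[b Pb <-] Vb]] : set_val @` P `&` V !=set0.
  by apply: clx => //; apply: (@filterS _ F _ P) => // b Pb; exists b.
by exists b; split => //; exact: VQ.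
Qed.

Lemma metrizable_subset (R : realType) (T : topologicalType) (A B : set T) :
  B `<=` A -> metrizable R A -> metrizable R B.
Proof.
move=> BA [d [d0 dC dD dnbhs]].
pose i (x : B) : A := SigSub (mem_set (BA _ (set_valP x))).
exists (fun x y => d (i x) (i y)); split=> [x y|x y|x y z|x] => //.
  by rewrite d0; split=> [/(congr1 val)/= xy|->//]; exact: val_inj.
apply/seteqP; split=> [U /nbhs_set_typeP[V Vx VU]|U [e /= e0 eU]].
  have : nbhs (i x) (set_val @^-1` V) by apply/nbhs_set_typeP; exists V.
  by rewrite dnbhs => -[e e0 eV]; exists e => // y /eV /VU.
have : nbhs (i x) [set z | (d (i x) z < e)%R] by rewrite dnbhs; exists e.
move=> /nbhs_set_typeP[V Vx VU]; apply/nbhs_set_typeP; exists V => // y Vy.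
by apply: eU; exact: (VU (i y)).
Qed.

(** * The spaces [star S W] *)

Section Star.
Context {G X : topologicalType} (S : set (C_s G X)).

(** Inseparable pairs share their first coordinate, which lies in both domains; hence the domains
    meet and the maps agree on the overlap. *)
Lemma star_hausdorff (W : set (G * X)) : hausdorff_space G ->
  hausdorff_space X -> hausdorff_space (star S W).
Proof.
move=> hG hX p q /(cluster_continuous _ (@set_val_continuous _ _)) pq.
apply: val_inj; move: (set_valP p) (set_valP q) pq; rewrite !set_valE /=.
move: (val p) (val q) => [g phi] [h psi] /=.
move=> [_ [a [/= ag _]]] [_ [b [/= bh _]]] pq.
have gh : g = h.
  apply: hG; apply: (cluster_continuous fst _ pq) => ?.
  exact: cvg_fst.
rewrite gh; congr (_, _); apply: val_inj.
have : cluster (nbhs (set_val phi)) (set_val psi).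
  apply: (cluster_continuous (set_val \o snd) _ pq) => x.
  by apply: continuous_comp; [exact: cvg_snd | exact: set_val_continuous].
move=> phipsi; apply: maximally_defined_eq.
- exact: set_valP phi.
- exact: set_valP psi.
- exists g; split; first by rewrite -ag; exact: set_valP.
  by rewrite gh -bh; exact: set_valP.
by move=> c d; exact: cluster_pmap_eq.
Qed.

(** With [K] mapped by [phi] into the interior of [L], the open condition [W(K, L°)] together with
    [g] in [K] forces membership in [star S (K x L)]. *)
Lemma star_locally_compact : hausdorff_space G -> locally_compact [set: G] ->
  hausdorff_space X -> locally_compact [set: X] -> compactness_axiom S ->
  locally_compact [set: star S setT].
Proof.
move=> hG lG hX lX cS p _; rewrite withinET.
have [Sp [a [ap _]]] := set_valP p; set phi := val (val p).2 in a ap *.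
have [L] := lX (phi a) I; rewrite withinET => La [cL _].
have La' : nbhs (phi a) L° by exact: nbhs_interior.
have [K [Ka cK _ KL]] :=
  compact_nbhs_pmap_subbasic hG lG filterT La'.
pose C := star S (K `*` L).
have cC : compact (set_val @^-1` C : set (star S setT)).
  apply: compact_set_type; first by apply: cS; exact: compact_setX.
  by move=> q [Sq [b [bq _]]]; split => //; exists b.
(* Local compactness asks for a neighborhood that is also closed, which the Hausdorff property
   provides. *)
exists (set_val @^-1` C); last first.
  by split => //; apply: compact_closed => //; exact: star_hausdorff.
have Kp : nbhs (val p).1 K by rewrite -ap.
have Wp : nbhs (val p).2 (set_val @^-1` pmap_subbasic (K, L°)).
  apply: set_val_continuous; apply: nbhs_pmap_subbasic => //.
  exact: open_interior.
apply/nbhs_set_typeP; exists (K `*` (set_val @^-1` pmap_subbasic (K, L°))).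
  by exists (K, set_val @^-1` pmap_subbasic (K, L°)).
move=> q [/= Kq /pmap_subbasicP Wq].
have [Sq _] := set_valP q; split => //.
have [b bq Lb] := Wq _ Kq; exists b; split => //; split => //.
exact: interior_subset Lb.
Qed.

End Star.

Theorem theorem2p16 (R : realType) (G : topologicalGroupType)
    (X : metricType R) (S : set (C_s G X)) :
  hausdorff_space G -> locally_compact [set: G] -> @second_countable G ->
  @second_countable X ->
  compactness_axiom S -> locally_compact [set: X] ->
  forall W : set (G * X), metrizable R (star S W).
Proof.
move=> hG lG sG sX cS lX W.
have hX : hausdorff_space X := @metric_hausdorff R X.
(* For arbitrary [W] the space [star S W] need not be locally compact, so the metric is built on the
   whole [star S setT] and restricted. *)
apply: (@metrizable_subset _ _ (star S setT)).
  by move=> q [Sq [b [bq _]]]; split => //; exists b.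
have hY : hausdorff_space (star S setT) by exact: star_hausdorff.
apply: completely_regular_metrizable => //.
  apply: (@locally_compact_completely_regular _ R) => //.
  exact: star_locally_compact.
apply: second_countable_set_type; apply: second_countable_prod => //.
by apply: second_countable_set_type; exact: second_countable_pmap.
Qed.
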